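(* For $f=\rho$ (the MNL choice function), the Deterministic Forward Approximation evaluated with the price trajectory $\tau^U$ is asymptotically optimal as $\lambda\to\infty$ (that is, for all $S\in\mathcal{P}(\mathcal{L})$, $V^{\mathrm{DFA}}_{T(\lambda)}(S)-V^*_{T(\lambda)}(S)\to0$), and for all $S\in\mathcal{P}(\mathcal{L})$, as $\lambda\to\infty$, $$\frac{V^{\mathrm{DFA}}_{T(\lambda)}(S)-V^*_{T(\lambda)}(S)}{V^*_{T(\lambda)}(S)}=O\left(\frac1\lambda\right)\qquad\text{and}\qquad\frac{V^{U}_{T(\lambda)}(S)-V^*_{T(\lambda)}(S)}{V^*_{T(\lambda)}(S)}=O\left(\frac1\lambda\right).$$
   Context: Items and options: $\mathcal{L}=\{1,\dots,L\}$ is a finite set of unique items; item $j$ has salvage value $\xi_j\in\mathbb{R}$. An option is a sequence of distinct items (a single item, or a bundle of two or more items); the salvage value $\xi_i$ of an option $i$ is the sum of the salvage values of its items. $\mathcal{O}$ is the set of all options with at most $K_b$ items, and $\mathcal{P}(\mathcal{L})$ is the collection of all sets $S\subseteq\mathcal{O}$ such that each item belongs to exactly one option of $S$ and $S$ contains at most $K_s$ bundles ($K_b,K_s$ given integers). Customers: $\Omega$ is a finite set of customer types; $X$ is a random type with probability mass function $p_X$ on $\Omega$, and $\mathbb{E}_X$ is expectation over $X$. In each period a customer arrives with probability $\mu\in(0,1]$ (fixed), with type distributed as $X$ independently across periods. For demand $\lambda\ge0$ the number of periods is $T(\lambda)=\lfloor\lambda/\mu\rfloor$; periods are indexed by remaining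 time $t$. Option $i$ has perceived quality $q_i^\omega\in\mathbb{R}$ for type $\omega$. The price sensitivity is $\beta_p<0$. MNL model: $\rho_i^\omega(p,S)=\dfrac{e^{q_i^\omega+\beta_pp_i}}{1+\sum_{j\in S}e^{q_j^\omega+\beta_pp_j}}$ for $i\in S$, $p\in\mathbb{R}^{|S|}$; in particular $\rho_i^\omega(p,\{i\})=e^{q_i^\omega+\beta_pp}/(1+e^{q_i^\omega+\beta_pp})$ for $p\in\mathbb{R}$. Its extension to availability vectors $a\in[0,1]^{|S|}$ is $$\tilde\rho_i^\omega(p,a)=\frac{e^{q_i^\omega+\beta_pp_i}}{1+e^{q_i^\omega+\beta_pp_i}+\sum_{j\in S\setminus\{i\}}a_je^{q_j^\omega+\beta_pp_j}}.$$ Value function: for every $S'$ contained in some member of $\mathcal{P}(\mathcal{L})$, $V_0^*(S')=\sum_{i\in S'}\xi_i$ and, for $t\ge1$, $V_t^*(S')=V_{t-1}^*(S')+\mu\,\mathbb{E}_X\big[R(\rho^X,S',\Delta V_t^*(S'))\big]$, where $\Delta_iV_t^*(S')=V^*_{t-1}(S')-V^*_{t-1}(S'\setminus\{i\})$ and $R(g,S',\Delta)=\max_{p\in\mathbb{R}^{|S'|}}\sum_{i\in S'}g_i(p,S')(p_i-\Delta_i)$. Backward upper bound: $r_{0,i}=\xi_i$, $r_{t,i}=r_{t-1,i}+\mu\,\mathbb{E}_X\big[\max_{p\in\mathbb{R}}\rho_i^X(p,\{i\})(p-r_{t-1,i})\big]$ for $t\ge1$, and $V_t^U(S)=\sum_{i\in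 S}r_{t,i}$. Price trajectory: $\tau^U_{t,i}=\max_{\omega\in\Omega}\big\{\operatorname{argmax}_{p\in\mathbb{R}}\rho_i^\omega(p,\{i\})(p-r_{t,i})\big\}$. DFA with trajectory $\tau^U$: define $\hat A_{T(\lambda),i}=1$ and $\hat A_{t-1,i}=\hat A_{t,i}\big(1-\mu\,\mathbb{E}_X[\tilde\rho_i^X(\tau^U_t,\hat A_t)]\big)$ for $t=1,\dots,T(\lambda)$, $i\in S$, and $$V^{\mathrm{DFA}}_{T(\lambda)}(S)=\sum_{i\in S}\hat A_{0,i}\xi_i+\mu\sum_{t=1}^{T(\lambda)}\sum_{i\in S}\hat A_{t,i}\,\mathbb{E}_X\big[\tilde\rho_i^X(\tau^U_t,\hat A_t)\big]\tau^U_{t,i}.$$ *)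

(* Defs.v *)
From HB Require Import structures.
From mathcomp Require Import all_boot all_order all_algebra.
From mathcomp Require Import all_classical all_reals all_analysis.

Set Implicit Arguments.
Unset Strict Implicit.
Unset Printing Implicit Defensive.

Import Order.TTheory GRing.Theory Num.Theory.
Import numFieldNormedType.Exports.
Local Open Scope classical_set_scope.
Local Open Scope ring_scope.

(* Needed to write f =O_ +oo g: the library has no [filter_on] for +oo. *)
Canonical pinfty_filter_on (R : numFieldType) :=
  FilterType (pinfty_nbhs R) _.

Section Maxima.
Variable R : realType.

(* Greatest element of [A]; the value 0 is junk, used only if there is none. *)
Definition max_of (A : set R) : R := xget 0 [set m | A m /\ ubound A m].

Definition argmax (f : R -> R) : set R := [set p | forall p', f p' <= f p].

End Maxima.

(* The set O: nonempty sequences of at most Kb distinct items of 'I_L. *)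
Definition opt (L Kb : nat) : finType :=
  {s : Kb.-bseq 'I_L | uniq s && (0 < size s)%N}.

Definition items (L Kb : nat) (o : opt L Kb) : seq 'I_L := val (val o).

Definition is_bundle (L Kb : nat) (o : opt L Kb) : bool := (1 < size (items o))%N.

Definition feasible (L Kb Ks : nat) : {set {set opt L Kb}} :=
  [set S : {set opt L Kb} |
    [forall j : 'I_L, #|[set o in S | j \in items o]| == 1%N]
    && (#|[set o in S | is_bundle o]| <= Ks)%N].

Section Model.
Variables (R : realType) (L Kb : nat) (Omega : finType).
Implicit Types (S : {set opt L Kb}) (i : opt L Kb) (w : Omega) (t T : nat).

(* A price vector in R^|S|, or an availability vector in [0,1]^|S|, is a
   function on all options, of which only the values on S are used. *)
Implicit Types (p a : opt L Kb -> R).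

Definition is_pmf (pX : Omega -> R) : Prop :=
  (forall w, 0 <= pX w) /\ \sum_(w : Omega) pX w = 1.

Definition expect (pX : Omega -> R) (f : Omega -> R) : R :=
  \sum_(w : Omega) pX w * f w.

Definition salvage (xi : 'I_L -> R) i : R := \sum_(j <- items i) xi j.

Definition max_revenue (g : opt L Kb -> (opt L Kb -> R) -> {set opt L Kb} -> R)
    S (Delta : opt L Kb -> R) : R :=
  max_of [set \sum_(i in S) g i p S * (p i - Delta i) | p in setT].

Section MNL.
Variables (betap : R) (q : Omega -> opt L Kb -> R).

Definition attraction w p i : R := expR (q w i + betap * p i).

Definition mnl w i p S : R :=
  attraction w p i / (1 + \sum_(j in S) attraction w p j).

Definition mnl_avail S w i p a : R :=
  attraction w p i /
    (1 + attraction w p i + \sum_(j in S :\ i) a j * attraction w p j).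

(* (x - c) * rho_i^w(x, {i}) for a scalar price x *)
Definition single_revenue w i (c x : R) : R :=
  mnl w i (fun=> x) [set i]%SET * (x - c).

Variables (mu : R) (xi : 'I_L -> R) (pX : Omega -> R).

Fixpoint Vstar t S : R :=
  match t with
  | 0%N => \sum_(i in S) salvage xi i
  | t'.+1 => Vstar t' S + mu * expect pX (fun w =>
      max_revenue (mnl w) S (fun i => Vstar t' S - Vstar t' (S :\ i)))
  end.

Fixpoint item_bound t i : R :=
  match t with
  | 0%N => salvage xi i
  | t'.+1 => item_bound t' i + mu * expect pX (fun w =>
      max_of (range (single_revenue w i (item_bound t' i))))
  end.

Definition VU t S : R := \sum_(i in S) item_bound t i.

(* tau^U_{t,i}; the union ranges over all types, including null ones. *)
Definition tauU t i : R :=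
  max_of (\bigcup_w argmax (single_revenue w i (item_bound t i))).

Definition mean_choice S i p a : R :=
  expect pX (fun w => mnl_avail S w i p a).

(* Forward recursion in the elapsed time k, i.e. remaining time T - k. *)
Fixpoint avail_elapsed S T (k : nat) i : R :=
  match k with
  | 0%N => 1
  | k'.+1 => avail_elapsed S T k' i *
      (1 - mu * mean_choice S i (tauU (T - k')%N) (avail_elapsed S T k'))
  end.

(* A^_{t,i} with horizon T, for t <= T *)
Definition avail S T t i : R := avail_elapsed S T (T - t)%N i.

Definition VDFA T S : R :=
  \sum_(i in S) avail S T 0 i * salvage xi i
  + mu * \sum_(1 <= t < T.+1) \sum_(i in S)
      avail S T t i * mean_choice S i (tauU t) (avail S T t) * tauU t i.

End MNL.

(* T(lambda) = floor (lambda / mu), for lambda >= 0 *)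
Definition periods (mu lambda : R) : nat := Num.truncn (lambda / mu).

End Model.

(* Main.v *)
(** At opportunity cost [r] the best single-option price is [r + 1 / b + m], with
    [b = - betap] and optimal value [m = W (exp (q - 1 - b r)) / b], [W] being the
    Lambert function. Hence [y_t = exp (b r_t)] grows linearly in [t]: the margins
    are O(1 / t), and Jensen's inequality gives [y_t <= y_0 + H t], where
    [H = mu E (exp (q - 1))] is the very constant for which the sale probability
    per period is at least [H / (y_t + O(1)) >= 1 / (t + B)].

    V^U - V^*: pricing each option as if it were alone loses only O(1 / t ^ 2) per
    period to V^U, through the interaction of at least two options. As long as two
    options are left, the accumulated gap is contracted by (1 - 1 / (t + B)) ^ 2
    in each period, so it is O(1 / t).

    V^U - V^DFA: by telescoping, this is the sum over the periods [t <= T] of the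
    availability, which is O(t / T), times the loss against the single-option
    optimum. That loss is O(1 / t ^ 3) by the second-order optimality of the price,
    plus an interaction term O(1 / t ^ 2) times another availability, so that the
    sum is O(1 / T).

    Finally V^* tends to infinity, so the absolute gaps bound the relative ones. *)

Require Import Defs.
From HB Require Import structures.
From mathcomp Require Import all_boot all_order all_algebra.
From mathcomp Require Import all_classical all_reals all_analysis.
From mathcomp Require Import ring lra.

Set Implicit Arguments.
Unset Strict Implicit.
Unset Printing Implicit Defensive.

Import Order.TTheory GRing.Theory Num.Theory.
Import numFieldNormedType.Exports.
Local Open Scope classical_set_scope.
Local Open Scope ring_scope.

(** * The Lambert function and inequalities for the exponential *)

Section Lambert.
Variable R : realType.
Implicit Types x y : R.

(* The branch W of the Lambert function on [0, +oo[. *)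
Definition lambert x : R := xget 0 [set v | 0 <= v /\ v * expR v = x].

Lemma lambertP x : 0 <= x -> 0 <= lambert x /\ lambert x * expR (lambert x) = x.
Proof.
move=> x0; apply: (@xgetPex _ 0 [set v | 0 <= v /\ v * expR v = x]).
have cf : continuous (fun v : R => v * expR v).
  by move=> v; apply: cvgM; [exact: cvg_id | exact: continuous_expR].
have le_x : x <= x * expR x by rewrite ler_peMr// -expR0 ler_expR.
have [|v] := @IVT R (fun v => v * expR v) 0 x x x0 (continuous_subspaceT cf).
  rewrite mul0r min_l ?max_r ?x0 ?le_x //; exact: le_trans le_x.
by rewrite in_itv /= => /andP[v0 _] vE; exists v.
Qed.

Lemma lambert_ge0 x : 0 <= x -> 0 <= lambert x.
Proof. by case/lambertP. Qed.

Lemma lambertK x : 0 <= x -> lambert x * expR (lambert x) = x.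
Proof. by case/lambertP. Qed.

Lemma lambert_gt0 x : 0 < x -> 0 < lambert x.
Proof.
move=> x0; have x0' := ltW x0; rewrite lt0r lambert_ge0// andbT.
by apply/eqP => E; move: (lambertK x0') x0; rewrite E mul0r => <-; rewrite ltxx.
Qed.

Lemma lambert_le x : 0 <= x -> lambert x <= x.
Proof.
move=> x0; rewrite -[leRHS](lambertK x0) ler_peMr ?lambert_ge0//.
by rewrite -expR0 ler_expR lambert_ge0.
Qed.

(** Multiply [1 - v <= exp (- v)] by [exp v] and use the equation [v * exp v = x]. *)
Lemma expR_lambert_le x : 0 <= x -> expR (lambert x) <= 1 + x.
Proof.
move=> x0; rewrite -{2}(lambertK x0); set v := lambert x.
have /(ler_wpM2l (expR_ge0 v)) := expR_ge1Dx (- v).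
rewrite expRN mulfV ?gt_eqF ?expR_gt0//; lra.
Qed.

Lemma lambert_ge x : 0 <= x -> x / (1 + x) <= lambert x.
Proof.
move=> x0; rewrite ler_pdivrMr; last by lra.
rewrite -{1}(lambertK x0) ler_wpM2l ?lambert_ge0//; exact: expR_lambert_le.
Qed.

Lemma ler_expR_pred x : x <= expR (x - 1).
Proof. by have := expR_ge1Dx (x - 1); lra. Qed.

Lemma expRN_mul1D_le1 x : expR (- x) * (1 + x) <= 1.
Proof.
have /(ler_wpM2l (expR_ge0 (- x))) := expR_ge1Dx x.
by rewrite -expRD addNr expR0.
Qed.

Lemma expRN_mul1D_lt1 x : x != 0 -> expR (- x) * (1 + x) < 1.
Proof.
move=> x0; have := expR_gt1Dx x0; rewrite -(ltr_pM2l (expR_gt0 (- x))).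
by rewrite -expRD addNr expR0.
Qed.

Lemma expRN_mul1D_ge x : 0 <= x -> 1 - x ^+ 2 <= expR (- x) * (1 + x).
Proof.
move=> x0; have x1 : 0 <= 1 + x by lra.
by have /(ler_wpM2r x1) := expR_ge1Dx (- x); rewrite expr2; lra.
Qed.

Lemma max_of_eq (A : set R) m : A m -> ubound A m -> max_of A = m.
Proof.
move=> Am ubm; apply: xget_unique => // y [Ay uby].
by apply/eqP; rewrite eq_le ubm// uby.
Qed.

End Lambert.

(** * Optimal prices and revenues, for one option and for a set of options *)

Section Revenue.
Variables (R : realType) (L Kb : nat) (Omega : finType).
Variables (betap : R) (q : Omega -> opt L Kb -> R).
Hypothesis betap_lt0 : betap < 0.
Implicit Types (S : {set opt L Kb}) (i : opt L Kb) (w : Omega).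
Implicit Types (p a Delta : opt L Kb -> R) (r x s : R).

Let betap_neq0 : betap != 0. Proof. by rewrite lt_eqF. Qed.

(* The optimal value of the single-option problem with opportunity cost [r]. *)
Definition margin w i r : R :=
  lambert (expR (q w i - 1 + betap * r)) / (- betap).

Definition myopic_price w i r : R := r + (- betap)^-1 + margin w i r.

Lemma margin_gt0 w i r : 0 < margin w i r.
Proof. by rewrite divr_gt0 ?lambert_gt0 ?expR_gt0 ?oppr_gt0. Qed.

Lemma lambert_margin w i r :
  lambert (expR (q w i - 1 + betap * r)) = - betap * margin w i r.
Proof. by rewrite [RHS]mulrC divfK// oppr_eq0. Qed.

(** This is the Lambert equation [v * exp v = z] in the form [z * exp (- v) = v]: at the optimal
    price the exponent is [ln z - v]. *)
Lemma attraction_myopic w i r :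
  expR (q w i + betap * myopic_price w i r) = - betap * margin w i r.
Proof.
rewrite -lambert_margin /myopic_price /margin.
set z := expR (q w i - 1 + betap * r); set v := lambert z.
have -> : q w i + betap * (r + (- betap)^-1 + v / - betap)
        = q w i - 1 + betap * r - v by field.
have zE : v * expR v = z by apply: lambertK; exact: expR_ge0.
by rewrite expRB -/z -zE mulfK// gt_eqF ?expR_gt0.
Qed.

(** Here [s] is the attraction of competing options and [u] the scaled deviation from the optimal
    price. The numerator separates the pricing error, of second order in [u], from the interaction,
    linear in [s]; the loss bounds below come from this identity. *)
Lemma margin_gap w i r x s : 0 <= s ->
  let a := expR (q w i + betap * x) in
  let u := - betap * (x - myopic_price w i r) in
  margin w i r - a / (1 + a + s) * (x - r)
  = margin w i r * (1 - expR (- u) * (1 + u) + s) / (1 + a + s).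
Proof.
move=> s0 a u; have a0 : 0 < a := expR_gt0 _.
have aE : a = - betap * margin w i r * expR (- u).
  rewrite -attraction_myopic -expRD /a /u; congr expR; ring.
have xE : x = r + (- betap)^-1 + margin w i r + u / - betap.
  by rewrite /u /myopic_price; field.
have d0 : 1 + a + s != 0 by rewrite gt_eqF//; lra.
have <- : margin w i r * (1 + a + s) - a * (x - r)
        = margin w i r * (1 - expR (- u) * (1 + u) + s).
  by rewrite [in LHS]xE aE; field.
by field.
Qed.

Lemma margin_gap_ge0 w i r x s : 0 <= s ->
  expR (q w i + betap * x) / (1 + expR (q w i + betap * x) + s) * (x - r)
  <= margin w i r.
Proof.
move=> s0; set a := expR (q w i + betap * x).
rewrite -subr_ge0 margin_gap// -/a; set u := - betap * _.
have a0 : 0 < a := expR_gt0 _; have m0 := margin_gt0 w i r.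
apply: divr_ge0; last by lra.
apply: mulr_ge0; first exact: ltW.
by have := expRN_mul1D_le1 u; lra.
Qed.

(** For [u >= 0], [1 - exp (- u) * (1 + u)] is at most [u ^+ 2], and the denominator is at least
    1. *)
Lemma margin_gap_le w i r x s : 0 <= s -> myopic_price w i r <= x ->
  margin w i r
    - expR (q w i + betap * x) / (1 + expR (q w i + betap * x) + s) * (x - r)
  <= margin w i r * ((- betap * (x - myopic_price w i r)) ^+ 2 + s).
Proof.
move=> s0 px; set a := expR (q w i + betap * x).
rewrite margin_gap// -/a; set u := - betap * _.
have a0 : 0 < a := expR_gt0 _; have m0 := margin_gt0 w i r.
have u0 : 0 <= u by rewrite mulr_ge0 ?subr_ge0 ?oppr_ge0// ltW.
have g0 := expRN_mul1D_le1 u; have g1 := expRN_mul1D_ge u0.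
rewrite ler_pdivrMr; last by lra.
rewrite -[leRHS]mulrA ler_wpM2l ?(ltW m0)//.
apply: (@le_trans _ _ (u ^+ 2 + s)); first by lra.
rewrite ler_peMr//; last by lra.
by rewrite addr_ge0// sqr_ge0.
Qed.

Lemma single_revenueE w i r x :
  single_revenue betap q w i r x =
  expR (q w i + betap * x) / (1 + expR (q w i + betap * x) + 0) * (x - r).
Proof. by rewrite /single_revenue /mnl big_set1 /attraction addr0. Qed.

Lemma single_revenue_le w i r x : single_revenue betap q w i r x <= margin w i r.
Proof. by rewrite single_revenueE margin_gap_ge0. Qed.

Lemma single_revenue_myopic w i r :
  single_revenue betap q w i r (myopic_price w i r) = margin w i r.
Proof.
apply/eqP; rewrite single_revenueE eq_sym -subr_eq0 margin_gap//=.
by rewrite subrr mulr0 oppr0 expR0 !addr0 mul1r subrr mulr0 mul0r.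
Qed.

Lemma single_revenue_lt w i r x : x != myopic_price w i r ->
  single_revenue betap q w i r x < margin w i r.
Proof.
move=> xp; rewrite -subr_gt0 single_revenueE margin_gap//; set a := expR (q w i + betap * x).
have a0 : 0 < a := expR_gt0 _; have m0 := margin_gt0 w i r.
apply: divr_gt0; last by lra.
apply: mulr_gt0 => //; rewrite addr0 subr_gt0 expRN_mul1D_lt1//.
by rewrite mulf_neq0 ?oppr_eq0 ?subr_eq0.
Qed.

Lemma max_single_revenue w i r :
  max_of (range (single_revenue betap q w i r)) = margin w i r.
Proof.
apply: max_of_eq; first by exists (myopic_price w i r); rewrite ?single_revenue_myopic.
by move=> _ [x _ <-]; exact: single_revenue_le.
Qed.

Lemma argmax_single_revenue w i r :
  argmax (single_revenue betap q w i r) = [set myopic_price w i r].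
Proof.
apply/seteqP; split=> [x /(_ (myopic_price w i r))|_ -> x] /=.
  rewrite single_revenue_myopic.
  case: (eqVneq x (myopic_price w i r)) => // /single_revenue_lt.
  by rewrite ltNge => /negbTE ->.
by rewrite single_revenue_myopic single_revenue_le.
Qed.

(* The larger the opportunity cost, the larger the optimal price: both satisfy
   [margin = expR (q - betap * price) / (- betap)], so that a smaller price
   would come with a larger margin. *)
Lemma le_myopic_price w i r r' : r <= r' -> myopic_price w i r <= myopic_price w i r'.
Proof.
move=> rr'; rewrite leNgt; apply/negP => lt_p.
have : margin w i r < margin w i r'.
  rewrite -(@ltr_pM2l _ (- betap)) ?oppr_gt0// -!attraction_myopic ltr_expR ltrD2l.
  by rewrite ltr_nM2l.
by move: lt_p; rewrite /myopic_price; lra.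
Qed.

Lemma margin_le w i r : - betap * margin w i r <= expR (q w i - 1 + betap * r).
Proof. by rewrite -lambert_margin lambert_le ?expR_ge0. Qed.

Lemma margin_ge w i r :
  expR (q w i - 1 + betap * r) / (1 + expR (q w i - 1 + betap * r))
  <= - betap * margin w i r.
Proof. by rewrite -lambert_margin lambert_ge ?expR_ge0. Qed.

Lemma expR_margin_le w i r :
  expR (- betap * margin w i r) <= 1 + expR (q w i - 1 + betap * r).
Proof. by rewrite -lambert_margin expR_lambert_le ?expR_ge0. Qed.

Lemma attraction_sum_gt0 w p S : 0 < 1 + \sum_(j in S) attraction betap q w p j.
Proof. by rewrite ltr_pwDl// sumr_ge0// => j _; exact: expR_ge0. Qed.

Lemma mnl_ge0 w i p S : 0 <= mnl betap q w i p S.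
Proof. by rewrite divr_ge0 ?expR_ge0// ltW// attraction_sum_gt0. Qed.

Lemma sum_mnl_le1 w p S : \sum_(i in S) mnl betap q w i p S <= 1.
Proof.
rewrite -mulr_suml ler_pdivrMr ?attraction_sum_gt0// mul1r; lra.
Qed.

Lemma mnl_margin_le w i p S r : i \in S ->
  mnl betap q w i p S * (p i - r) <= margin w i r.
Proof.
move=> iS; rewrite /mnl (bigD1 i)//= addrA; apply: margin_gap_ge0.
by rewrite sumr_ge0// => j _; exact: expR_ge0.
Qed.

(** Attainment has to be proved: without a greatest element, [max_of] would return its default value
    0. *)
Lemma max_revenueP w S Delta :
  (exists p, max_revenue (mnl betap q w) S Delta
     = \sum_(i in S) mnl betap q w i p S * (p i - Delta i)) /\
  (forall p, \sum_(i in S) mnl betap q w i p S * (p i - Delta i)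
     <= max_revenue (mnl betap q w) S Delta).
Proof.
set rev := fun p => \sum_(i in S) mnl betap q w i p S * (p i - Delta i).
suff [p pmax] : exists p, forall p', rev p' <= rev p.
  have -> : max_revenue (mnl betap q w) S Delta = rev p.
    by apply: max_of_eq => [|_ [p' _ <-]]; [exists p|exact: pmax].
  by split; [exists p|].
(* With [Z] the sum below and [theta = W Z / - betap], the prices
   [Delta + 1 / - betap + theta] are optimal, of value [theta]. *)
set Z := \sum_(i in S) expR (q w i - 1 + betap * Delta i).
have Z0 : 0 <= Z by rewrite sumr_ge0// => i _; exact: expR_ge0.
set theta := lambert Z / - betap.
have thetaE : theta = Z * expR (betap * theta) / - betap.
  rewrite {1}/theta -{2}(lambertK Z0); congr (_ / _).
  rewrite -mulrA -expRD /theta.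
  have -> : lambert Z + betap * (lambert Z / - betap) = 0 by field.
  by rewrite expR0 mulr1.
(* Since [num p - theta] is [rev p - theta] times a positive factor, comparing [rev p] with [theta]
   amounts to comparing [num p] with it, and [num] is separable in the options. *)
pose num p := \sum_(i in S) attraction betap q w p i * (p i - Delta i - theta).
have numE p : num p = (rev p - theta) * (1 + \sum_(i in S) attraction betap q w p i) + theta.
  have d0 := lt0r_neq0 (attraction_sum_gt0 w p S).
  have revd : rev p * (1 + \sum_(i in S) attraction betap q w p i)
            = \sum_(i in S) attraction betap q w p i * (p i - Delta i).
    by rewrite mulr_suml; apply: eq_bigr => i _; rewrite mulrAC /mnl divfK.
  rewrite mulrBl revd /num.
  under eq_bigr do rewrite mulrBr.
  by rewrite sumrB -mulr_suml; ring.
have le_theta p : num p <= theta -> rev p <= theta.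
  rewrite numE => le_n; rewrite -subr_le0.
  rewrite -(@pmulr_lle0 _ (1 + \sum_(i in S) attraction betap q w p i)).
    by lra.
  exact: attraction_sum_gt0.
have eq_theta p : num p = theta -> rev p = theta.
  rewrite numE => /eqP; rewrite -subr_eq0 addrK mulf_eq0.
  by rewrite (gt_eqF (attraction_sum_gt0 w p S)) orbF subr_eq0 => /eqP.
(* With [v = - betap * (x - Delta i - theta)], each term is a constant times [v * exp (1 - v)],
   which is at most 1, with equality at [v = 1]. *)
have termE i x : expR (q w i + betap * x) * (x - Delta i - theta)
  = expR (q w i - 1 + betap * Delta i) * expR (betap * theta) / - betap
    * (- betap * (x - Delta i - theta) * expR (- (- betap * (x - Delta i - theta) - 1))).
  have -> : q w i + betap * x = q w i - 1 + betap * Delta i + betap * theta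
       + - (- betap * (x - Delta i - theta) - 1) by ring.
  by rewrite 2!expRD; field.
have thetaS : theta = \sum_(i in S)
    expR (q w i - 1 + betap * Delta i) * expR (betap * theta) / - betap.
  by rewrite {1}thetaE !mulr_suml.
exists (fun i => Delta i + (- betap)^-1 + theta) => p.
have -> : rev (fun i => Delta i + (- betap)^-1 + theta) = theta.
  apply: eq_theta; rewrite [RHS]thetaS; apply: eq_bigr => i _.
  rewrite /attraction /= termE.
  have -> : - betap * (Delta i + (- betap)^-1 + theta - Delta i - theta) = 1 by field.
  by rewrite subrr oppr0 expR0 !mulr1.
apply: le_theta; rewrite [leRHS]thetaS; apply: ler_sum => i _; rewrite termE.
rewrite ler_piMr//; first by rewrite divr_ge0 ?oppr_ge0 ?mulr_ge0 ?expR_ge0// ltW.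
set v := - betap * _; rewrite expRN ler_pdivrMr ?expR_gt0// mul1r.
exact: ler_expR_pred.
Qed.

End Revenue.

(** * Expectation over customer types *)

Section Expectation.
Variables (R : realType) (Omega : finType) (pX : Omega -> R).
Hypothesis pX_pmf : is_pmf pX.
Implicit Types f g : Omega -> R.

Lemma le_expect f g : (forall w, f w <= g w) -> expect pX f <= expect pX g.
Proof. by move=> fg; apply: ler_sum => w _; rewrite ler_wpM2l// pX_pmf.1. Qed.

Lemma expect_ge0 f : (forall w, 0 <= f w) -> 0 <= expect pX f.
Proof. by move=> f0; apply: sumr_ge0 => w _; rewrite mulr_ge0// pX_pmf.1. Qed.

Lemma expect_cst (c : R) : expect pX (fun=> c) = c.
Proof. by rewrite /expect -mulr_suml pX_pmf.2 mul1r. Qed.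

Lemma expectD f g : expect pX (fun w => f w + g w) = expect pX f + expect pX g.
Proof. by rewrite /expect -big_split/=; apply: eq_bigr => w _; rewrite mulrDr. Qed.

Lemma expectZ (c : R) f : expect pX (fun w => c * f w) = c * expect pX f.
Proof. by rewrite /expect mulr_sumr; apply: eq_bigr => w _; rewrite mulrCA. Qed.

Lemma expectB f g : expect pX (fun w => f w - g w) = expect pX f - expect pX g.
Proof. by rewrite /expect -sumrB; apply: eq_bigr => w _; rewrite mulrBr. Qed.

Lemma expect_sum (I : finType) (P : pred I) (F : I -> Omega -> R) :
  expect pX (fun w => \sum_(i | P i) F i w) = \sum_(i | P i) expect pX (F i).
Proof.
by rewrite /expect exchange_big/=; apply: eq_bigr => w _; rewrite mulr_sumr.
Qed.

Lemma expect_gt0 f : (forall w, 0 < f w) -> 0 < expect pX f.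
Proof.
move=> f0; have [w pw] : exists w, pX w != 0.
  apply/existsP; rewrite -[X in is_true X]negbK negb_exists; apply/negP => /forallP pX0.
  have /eqP := pX_pmf.2; rewrite big1 ?(eq_sym 0) ?oner_eq0// => w _.
  by apply/eqP; rewrite -[_ == _]negbK.
rewrite /expect (bigD1 w)//= ltr_pwDl ?mulr_gt0// ?lt0r ?pw ?pX_pmf.1//.
by apply: sumr_ge0 => w' _; rewrite mulr_ge0 ?pX_pmf.1// ltW.
Qed.

Lemma expect_le f (c : R) : (forall w, f w <= c) -> expect pX f <= c.
Proof. by move=> /le_expect; rewrite expect_cst. Qed.

Lemma pmf_inhabited : exists w : Omega, true.
Proof.
have [/card_gt0P[w _]|] := ltnP 0 #|Omega|; first by exists w.
rewrite leqn0 => /eqP/card0_eq Omega0; have := pX_pmf.2.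
by rewrite big_pred0 // => /eqP; rewrite eq_sym oner_eq0.
Qed.

(* Jensen's inequality for the mixture of 0 (weight [1 - mu]) and [f]. *)
Lemma expR_expect_le (mu : R) f : 0 <= mu -> mu <= 1 ->
  expR (mu * expect pX f) <= 1 - mu + mu * expect pX (fun w => expR (f w)).
Proof.
move=> mu0 mu1; set m := mu * expect pX f.
(* Tangent of the exponential at [m], used at [f w] and, for the weight [1 - mu], at 0. *)
have tangent x : expR m * (1 - m) + expR m * x <= expR x.
  have /(ler_wpM2l (expR_ge0 m)) := expR_ge1Dx (x - m).
  by rewrite -expRD [m + _]addrC subrK; lra.
have /(ler_wpM2l mu0) := le_expect (fun w => tangent (f w)).
rewrite expectD expect_cst// expectZ.
have -> : mu * (expR m * (1 - m) + expR m * expect pX f)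
        = mu * (expR m * (1 - m)) + expR m * m by rewrite /m; ring.
have : 0 <= 1 - mu by lra.
move=> /ler_wpM2l /(_ _ _ (tangent 0)); rewrite expR0 mulr0 addr0 mulr1.
lra.
Qed.

End Expectation.

Lemma finite_ubound (R : realType) (T : finType) (f : T -> R) :
  exists2 M : R, 0 < M & forall x, f x <= M.
Proof.
exists (1 + \sum_x `|f x|); first by rewrite ltr_pwDl// sumr_ge0.
move=> x; rewrite (bigD1 x)//=; have := ler_norm (f x).
have : 0 <= \sum_(i | i != x) `|f i| by rewrite sumr_ge0.
lra.
Qed.

Lemma sum_le_card (R : realType) (T : finType) (P : pred T) (F : T -> R) (c : R) :
  0 <= c -> (forall x, P x -> F x <= c) -> \sum_(x | P x) F x <= #|T|%:R * c.
Proof.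
move=> c0 leF; apply: (@le_trans _ _ (\sum_(x | P x) c)); first exact: ler_sum.
by rewrite sumr_const -[leLHS]mulr_natl ler_wpM2r// ler_nat max_card.
Qed.

(** * Linear growth of exp (b r_t) and decay of the margins *)

Section Growth.
Variables (R : realType) (L Kb : nat) (Omega : finType).
Variables (xi : 'I_L -> R) (pX : Omega -> R) (mu betap : R).
Variable q : Omega -> opt L Kb -> R.
Hypotheses (pX_pmf : is_pmf pX) (mu_gt0 : 0 < mu) (mu_le1 : mu <= 1).
Hypothesis betap_lt0 : betap < 0.
Implicit Types (i : opt L Kb) (w : Omega) (t : nat).

Local Notation r := (item_bound betap q mu xi pX).
Local Notation tau := (tauU betap q mu xi pX).
Local Notation E := (expect pX).
Local Notation margin := (margin betap q).

Let betapN_gt0 : 0 < - betap. Proof. by rewrite oppr_gt0. Qed.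

Lemma item_boundS t i : r t.+1 i = r t i + mu * E (fun w => margin w i (r t i)).
Proof.
by rewrite /=; congr (_ + _ * _); apply: eq_bigr => w _; rewrite max_single_revenue.
Qed.

Lemma le_item_boundS t i : r t i <= r t.+1 i.
Proof.
rewrite item_boundS lerDl mulr_ge0 ?expect_ge0 ?ltW// => w.
by rewrite ltW// margin_gt0.
Qed.

(** Every argmax is a singleton, so the union is a finite set of prices, nonempty as a type exists;
    hence its maximum is attained and [max_of] returns it. *)
Lemma tauUP t i :
  (exists w, tau t i = myopic_price betap q w i (r t i)) /\
  forall w, myopic_price betap q w i (r t i) <= tau t i.
Proof.
have [w0 _] := pmf_inhabited pX_pmf.
pose f w := myopic_price betap q w i (r t i).
case: (@arg_maxP _ _ _ w0 predT f isT) => w _ wmax.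
suff -> : tau t i = f w by split=> [|w']; [exists w | exact: wmax].
apply: max_of_eq.
  by exists w => //; rewrite argmax_single_revenue.
by move=> x [w' _]; rewrite argmax_single_revenue// => ->; exact: wmax.
Qed.

(** [weight / growth] is the Lambert argument in [margin]: the numerator carries the dependence on
    the type, the denominator the dependence on time. *)
Definition weight w i : R := expR (q w i - 1).
Definition growth t i : R := expR (- betap * r t i).

Lemma weight_gt0 w i : 0 < weight w i. Proof. exact: expR_gt0. Qed.
Lemma growth_gt0 t i : 0 < growth t i. Proof. exact: expR_gt0. Qed.
Let weight_neq0 w i : weight w i != 0. Proof. by rewrite gt_eqF ?expR_gt0. Qed.
Let growth_neq0 t i : growth t i != 0. Proof. by rewrite gt_eqF ?expR_gt0. Qed.

Lemma weight_growth w t i : expR (q w i - 1 + betap * r t i) = weight w i / growth t i.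
Proof. by rewrite expRD /growth mulNr expRN invrK. Qed.

Lemma margin_growth_le w t i : - betap * margin w i (r t i) <= weight w i / growth t i.
Proof. by rewrite -weight_growth margin_le. Qed.

Lemma margin_growth_ge w t i :
  weight w i / (growth t i + weight w i) <= - betap * margin w i (r t i).
Proof.
apply: le_trans (margin_ge q betap_lt0 _ _ _); rewrite weight_growth.
have := weight_gt0 w i; have := growth_gt0 t i => y0 c0.
by rewrite le_eqVlt; apply/orP; left; apply/eqP; field; rewrite !gt_eqF//; lra.
Qed.

Lemma growthS t i :
  growth t.+1 i = growth t i * expR (mu * E (fun w => - betap * margin w i (r t i))).
Proof. by rewrite -expRD expectZ /growth item_boundS mulrDr (mulrCA mu). Qed.

Lemma le_growthS t i : growth t i <= growth t.+1 i.
Proof. by rewrite ler_expR ler_wpM2l ?le_item_boundS// ltW. Qed.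

Lemma growth0_le t i : growth 0 i <= growth t i.
Proof. by elim: t => // t IH; exact: le_trans IH (le_growthS _ _). Qed.

Definition growth_rate i : R := mu * E (weight ^~ i).

Lemma growth_rate_gt0 i : 0 < growth_rate i.
Proof. by rewrite mulr_gt0 ?expect_gt0// => w; exact: weight_gt0. Qed.

(** By Jensen and [exp (W z) <= 1 + z], one period multiplies [y = growth t i] by at most
    [1 + growth_rate i / y]. *)
Lemma growthS_le t i : growth t.+1 i <= growth t i + growth_rate i.
Proof.
rewrite growthS; have y0 := growth_gt0 t i.
apply: le_trans (ler_wpM2l (ltW y0) (expR_expect_le pX_pmf _ (ltW mu_gt0) mu_le1)) _.
have e_le w : expR (- betap * margin w i (r t i)) <= 1 + (growth t i)^-1 * weight w i.
  apply: le_trans (expR_margin_le q betap_lt0 _ _ _) _.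
  by rewrite weight_growth [X in _ + X <= _]mulrC.
have := le_expect pX_pmf e_le; rewrite expectD expect_cst// expectZ /growth_rate.
move=> /(ler_wpM2l (ltW mu_gt0)) e_le'.
apply: le_trans
  (_ : growth t i * (1 - mu + mu * (1 + (growth t i)^-1 * E (weight ^~ i))) <= _).
  by rewrite ler_wpM2l ?(ltW y0)// lerD2l.
by rewrite le_eqVlt; apply/orP; left; apply/eqP; field.
Qed.

Lemma growth_le t i : growth t i <= growth 0 i + growth_rate i * t%:R.
Proof.
elim: t => [|t IH]; first by rewrite mulr0 addr0.
by apply: le_trans (growthS_le _ _) _; rewrite -natr1; lra.
Qed.

(** A cruder slope, for the lower bound: [W z >= z / (1 + z)] gives increments [y * c / (y + c)],
    nondecreasing in [y], so the value at [y = growth 0 i] serves for all periods. *)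
Definition growth_rate_low i : R :=
  mu * E (fun w => growth 0 i * (weight w i / (growth 0 i + weight w i))).

Lemma growth_rate_low_gt0 i : 0 < growth_rate_low i.
Proof.
rewrite mulr_gt0// expect_gt0// => w; have c0 := weight_gt0 w i.
by rewrite mulr_gt0 ?divr_gt0 ?addr_gt0 ?growth_gt0.
Qed.

Lemma growth_ge t i : growth 0 i + growth_rate_low i * t%:R <= growth t i.
Proof.
elim: t => [|t IH]; first by rewrite mulr0 addr0.
suff : growth t i + growth_rate_low i <= growth t.+1 i by rewrite -natr1; lra.
rewrite growthS; have y0 := growth_gt0 t i.
apply: le_trans (ler_wpM2l (ltW y0) (expR_ge1Dx _)).
rewrite mulrDr mulr1 lerD2l mulrCA -expectZ ler_wpM2l ?(ltW mu_gt0)//.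
apply: le_expect => // w; apply: le_trans (ler_wpM2l (ltW y0) (margin_growth_ge w t i)).
have c0 := weight_gt0 w i; have z0 := growth_gt0 0 i; have zy := growth0_le t i.
rewrite !mulrA ler_pdivrMr ?addr_gt0// mulrAC ler_pdivlMr ?addr_gt0//.
have : growth 0 i * weight w i * weight w i <= growth t i * weight w i * weight w i.
  by rewrite !ler_wpM2r// ltW.
lra.
Qed.

Lemma growth_linear : exists kappa Q : R, [/\ 0 < kappa, 0 < Q &
  forall t i, kappa * t.+1%:R <= growth t i <= Q * t.+1%:R].
Proof.
(* Upper bounds on the inverses yield positive lower bounds uniform in [i]. *)
have [M1 M1_gt0 le_M1] := finite_ubound (fun i => (growth 0 i)^-1).
have [M2 M2_gt0 le_M2] := finite_ubound (fun i => (growth_rate_low i)^-1).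
have [Q1 Q1_gt0 le_Q1] := finite_ubound (growth 0).
have [Q2 Q2_gt0 le_Q2] := finite_ubound growth_rate.
exists (M1 + M2)^-1, (Q1 + Q2); rewrite invr_gt0 !addr_gt0//; split=> // t i.
have t0 : 0 <= t%:R :> R by [].
apply/andP; split.
  apply: le_trans (growth_ge t i); rewrite -natr1 mulrDr mulr1 addrC lerD//.
    rewrite -[leRHS]invrK lef_pV2 ?posrE ?addr_gt0 ?invr_gt0 ?growth_gt0//.
    by have := le_M1 i; lra.
  rewrite ler_wpM2r// -[leRHS]invrK lef_pV2 ?posrE ?addr_gt0 ?invr_gt0 ?growth_rate_low_gt0//.
  by have := le_M2 i; lra.
apply: le_trans (growth_le t i) _; rewrite -natr1 mulrDr mulr1 addrC lerD//.
  by rewrite ler_wpM2r//; have := le_Q2 i; lra.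
by have := le_Q1 i; lra.
Qed.

Lemma item_bound_ge_eventually (Z : R) :
  exists t0, forall t i, (t0 <= t)%N -> Z <= r t i.
Proof.
have [kappa [Q [k0 Q0 gr]]] := growth_linear.
exists (Num.truncn (expR (- betap * Z) / kappa)) => t i t0t.
rewrite -(ler_pM2l betapN_gt0) -ler_expR -/(growth t i).
have /andP[+ _] := gr t i; apply: le_trans.
rewrite [kappa * _]mulrC -ler_pdivrMr// ltW//.
by apply: lt_le_trans (truncnS_gt _) _; rewrite ler_nat ltnS.
Qed.

Lemma margin_decay : exists2 A : R, 0 < A & forall w t i,
  - betap * margin w i (r t i) <= A / t.+1%:R.
Proof.
have [kappa [Q [k0 Q0 gr]]] := growth_linear.
have [M M0 le_M] := finite_ubound (fun wi => weight wi.1 wi.2).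
exists (M / kappa); first by rewrite divr_gt0.
move=> w t i; apply: le_trans (margin_growth_le w t i) _.
rewrite -mulrA -invfM ler_pM ?invr_ge0 ?(ltW (weight_gt0 _ _)) ?(ltW (growth_gt0 _ _))//.
  exact: (le_M (w, i)).
by rewrite lef_pV2 ?posrE ?mulr_gt0 ?growth_gt0//; case/andP: (gr t i).
Qed.

Lemma weight_ubound : exists2 M : R, 0 < M & forall w i, weight w i <= M.
Proof.
have [M M0 le_M] := finite_ubound (fun wi => weight wi.1 wi.2).
by exists M => // w i; exact: (le_M (w, i)).
Qed.

(* Since [growth t i <= growth 0 i + growth_rate i * t], a purchase probability
   of order [weight / (growth + O(1))] averages to at least [1 / (t + O(1))],
   with leading constant exactly 1. *)
Lemma choice_lower_bound (M G : R) : 0 <= M -> 0 <= G ->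
  exists2 B : R, 2 <= B & forall t i (P : Omega -> R),
    (forall w, weight w i / (growth t i + M) / (1 + G / t.+1%:R) <= P w) ->
    (t%:R + B)^-1 <= mu * E P.
Proof.
move=> M0 G0; have [kappa [Q [k0 Q0 gr]]] := growth_linear.
(* [K] is chosen so that [(y + M) * (1 + G / (t + 1)) <= y + K], using [y <= Q * (t + 1)]. *)
pose K := M + Q * G + M * G.
(* [B] satisfies [growth 0 i + K <= B * growth_rate i], so that the slope of the upper bound on
   [growth] cancels against the mean weight in the choice probability. *)
have [B B0 le_B] := finite_ubound (fun i => (growth 0 i + K) / growth_rate i).
exists (2 + B); first by lra.
move=> t i P leP; have y0 := growth_gt0 t i; have z0 := growth_gt0 0 i.
have H0 := growth_rate_gt0 i; have tS : 0 < t.+1%:R :> R by [].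
have K0 : 0 <= K by rewrite !addr_ge0 ?mulr_ge0// ltW.
have yK : 0 < growth t i + K by rewrite ltr_pwDl.
have G1 : 0 < 1 + G / t.+1%:R by rewrite ltr_pwDl ?divr_ge0.
have lePw w : (growth t i + K)^-1 * weight w i <= P w.
  apply: le_trans (leP w); rewrite mulrC -[leRHS]mulrA -invfM.
  rewrite ler_wpM2l ?(ltW (weight_gt0 _ _))// lef_pV2 ?posrE ?mulr_gt0 ?ltr_pwDl ?divr_ge0//.
  rewrite mulrDr mulr1 mulrDl /K.
  have -> : growth t i * (G / t.+1%:R) = growth t i / t.+1%:R * G by ring.
  have : growth t i / t.+1%:R * G <= Q * G.
    by rewrite ler_wpM2r// ler_pdivrMr//; case/andP: (gr t i).
  have : M * (G / t.+1%:R) <= M * G.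
    by rewrite ler_wpM2l// ler_piMr// invf_le1// ler1n.
  by move=> leM leQ; rewrite -!addrA !lerD2l [leLHS]addrC [leRHS]addrC lerD.
have /(ler_wpM2l (ltW mu_gt0)) := le_expect pX_pmf lePw.
apply: le_trans; rewrite expectZ mulrCA -/(growth_rate i) mulrC -ler_pdivrMl//.
rewrite -invfM lef_pV2 ?posrE//; last by rewrite mulr_gt0// ltr_wpDl// addr_gt0.
have := le_B i; rewrite ler_pdivrMr//; have := growth_le t i; nra.
Qed.

End Growth.

(** * The gap between V^U and V^* *)

Section Gap.
Variables (R : realType) (L Kb : nat) (Omega : finType).
Variables (xi : 'I_L -> R) (pX : Omega -> R) (mu betap : R).
Variable q : Omega -> opt L Kb -> R.
Hypotheses (pX_pmf : is_pmf pX) (mu_gt0 : 0 < mu) (mu_le1 : mu <= 1).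
Hypothesis betap_lt0 : betap < 0.
Implicit Types (S : {set opt L Kb}) (i : opt L Kb) (w : Omega) (t : nat).

Local Notation r := (item_bound betap q mu xi pX).
Local Notation V := (Vstar betap q mu xi pX).
Local Notation U := (VU betap q mu xi pX).
Local Notation E := (expect pX).
Local Notation margin := (margin betap q).
Local Notation mnl := (mnl betap q).
Local Notation N := #|opt L Kb|%:R.

Let betapN_gt0 : 0 < - betap. Proof. by rewrite oppr_gt0. Qed.

Definition gap t S : R := U t S - V t S.

Lemma gap0 S : gap 0 S = 0.
Proof. exact: subrr. Qed.

Lemma VUD1 t S i : i \in S -> U t S = r t i + U t (S :\ i).
Proof. by move=> iS; rewrite /VU (big_setD1 i). Qed.

Lemma VUS t S :
  U t.+1 S = U t S + mu * E (fun w => \sum_(i in S) margin w i (r t i)).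
Proof.
rewrite /VU expect_sum mulr_sumr -big_split/=; apply: eq_bigr => i _.
exact: item_boundS.
Qed.

Lemma Vstar_marginal t S i : i \in S ->
  V t S - V t (S :\ i) = r t i - gap t S + gap t (S :\ i).
Proof. by move=> iS; rewrite /gap (VUD1 _ iS); ring. Qed.

(** Replacing [r t i] by the true marginal value raises the unit profit by at most [gap t S], as the
    other gap is nonnegative by induction. Purchase probabilities sum to at most 1, so in one period
    [V] catches up with [U] by at most [mu * gap t S]. *)
Lemma gap_ge0 t S : 0 <= gap t S.
Proof.
elim: t S => [|t IH] S; first by rewrite gap0.
have le_rev w : max_revenue (mnl w) S (fun i => V t S - V t (S :\ i))
    <= \sum_(i in S) margin w i (r t i) + gap t S.
  have [[p ->] _] := max_revenueP q betap_lt0 w S (fun i => V t S - V t (S :\ i)).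
  apply: (@le_trans _ _ (\sum_(i in S) (margin w i (r t i) + mnl w i p S * gap t S))).
    apply: ler_sum => i iS; rewrite Vstar_marginal//.
    have := mnl_margin_le q betap_lt0 w p (r t i) iS.
    by have := mulr_ge0 (mnl_ge0 betap q w i p S) (IH (S :\ i)); lra.
  by rewrite big_split/= lerD2l -mulr_suml ler_piMl// sum_mnl_le1.
have /(ler_wpM2l (ltW mu_gt0)) := le_expect pX_pmf le_rev.
rewrite expectD expect_cst// /gap VUS /= -/(gap t S) => le_rev'.
have : mu * gap t S <= gap t S by rewrite ler_piMl.
by move: le_rev'; rewrite mulrDr /gap; lra.
Qed.

Let myopic t w i : R := myopic_price betap q w i (r t i).

Definition sale_prob t S i : R := mu * E (fun w => mnl w i (myopic t w) S).

Lemma mnl_myopic t w S i :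
  mnl w i (myopic t w) S
  = (- betap * margin w i (r t i)) / (1 + \sum_(j in S) - betap * margin w j (r t j)).
Proof.
rewrite /Defs.mnl /attraction attraction_myopic//; congr (_ / (1 + _)).
by apply: eq_bigr => j _; rewrite attraction_myopic.
Qed.

(** The myopic prices are one candidate in the maximum defining [V]. A sale of [i] replaces the gap
    of [S] by that of [S :\ i]; the last term bounds what the competing options cost against the
    single-option margins. *)
Lemma gapS_le t S :
  gap t.+1 S <= gap t S * (1 - \sum_(i in S) sale_prob t S i)
    + \sum_(i in S) sale_prob t S i * gap t (S :\ i)
    + mu * E (fun w => \sum_(i in S)
        margin w i (r t i) * \sum_(j in S :\ i) - betap * margin w j (r t j)).
Proof.
pose loss w i := margin w i (r t i) * \sum_(j in S :\ i) - betap * margin w j (r t j).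
pose g w i := mnl w i (myopic t w) S.
have le_rev w : \sum_(i in S) (margin w i (r t i) - loss w i + g w i * gap t S
      - g w i * gap t (S :\ i))
    <= max_revenue (mnl w) S (fun i => V t S - V t (S :\ i)).
  have [_ /(_ (myopic t w))] := max_revenueP q betap_lt0 w S (fun i => V t S - V t (S :\ i)).
  apply: le_trans; apply: ler_sum => i iS; rewrite Vstar_marginal// -/(g w i).
  have s0 : 0 <= \sum_(j in S :\ i) - betap * margin w j (r t j).
    by rewrite sumr_ge0// => j _; rewrite mulr_ge0 ?ltW// margin_gt0.
  (* At the myopic price the deviation [u] vanishes, so only the interaction term is lost. *)
  have := margin_gap_le betap_lt0 s0 (lexx (myopic_price betap q w i (r t i))).
  rewrite subrr mulr0 expr0n/= add0r -/(loss w i) attraction_myopic//.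
  have -> : - betap * margin w i (r t i) / (1 + - betap * margin w i (r t i)
      + \sum_(j in S :\ i) - betap * margin w j (r t j)) = g w i.
    by rewrite /g mnl_myopic (big_setD1 i iS)/= addrA.
  by rewrite /myopic; lra.
have /(ler_wpM2l (ltW mu_gt0)) := le_expect pX_pmf le_rev.
rewrite /gap VUS /= -/(gap t S).
have -> : E (fun w => \sum_(i in S) (margin w i (r t i) - loss w i + g w i * gap t S
      - g w i * gap t (S :\ i)))
    = E (fun w => \sum_(i in S) margin w i (r t i)) - E (fun w => \sum_(i in S) loss w i)
      + (\sum_(i in S) E (g ^~ i)) * gap t S - \sum_(i in S) E (g ^~ i) * gap t (S :\ i).
  rewrite !expect_sum mulr_suml -sumrB -big_split/= -sumrB; apply: eq_bigr => i _.
  rewrite !(expectB, expectD); congr (_ + _ - _).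
    by rewrite mulrC -expectZ; apply: eq_bigr => w _; rewrite [g w i * _]mulrC.
  by rewrite mulrC -expectZ; apply: eq_bigr => w _; rewrite [g w i * _]mulrC.
have -> : \sum_(i in S) sale_prob t S i = mu * \sum_(i in S) E (g ^~ i).
  by rewrite mulr_sumr.
have -> : \sum_(i in S) sale_prob t S i * (U t (S :\ i) - V t (S :\ i))
    = mu * \sum_(i in S) E (g ^~ i) * gap t (S :\ i).
  by rewrite mulr_sumr; apply: eq_bigr => i _; rewrite mulrA.
by rewrite -/(loss) /gap; lra.
Qed.

(** Without a competitor the interaction term is an empty sum. The contraction in [gap_decay] needs
    two options, so this case is separate. *)
Lemma gap_le1_eq0 t S : (#|S| <= 1)%N -> gap t S = 0.
Proof.
elim: t S => [|t IH] S S1; first exact: gap0.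
have SD0 i : i \in S -> S :\ i = finset.set0.
  by move=> iS; move: S1; rewrite (cardsD1 i) iS ltnS leqn0 cards_eq0 => /eqP.
apply/eqP; rewrite eq_le gap_ge0 andbT; apply: le_trans (gapS_le t S) _.
rewrite IH// mul0r add0r big1 => [|i iS]; last first.
  by rewrite IH ?mulr0// (leq_trans _ S1)// subset_leq_card// subD1set.
rewrite add0r (_ : E _ = 0) ?mulr0//.
rewrite /expect big1// => w _; rewrite big1 ?mulr0// => i iS.
by rewrite SD0// big_set0 mulr0.
Qed.

Lemma sale_prob_le A : (forall w t i, - betap * margin w i (r t i) <= A / t.+1%:R) ->
  forall t S i, sale_prob t S i <= A / t.+1%:R.
Proof.
move=> leA t S i; apply: (@le_trans _ _ (E (fun w => mnl w i (myopic t w) S))).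
  by rewrite ler_piMl// expect_ge0// => w; exact: mnl_ge0.
apply: expect_le => // w; apply: le_trans (leA w t i); rewrite mnl_myopic.
have m0 j : 0 <= - betap * margin w j (r t j) by rewrite mulr_ge0 ?ltW ?margin_gt0.
by rewrite ler_pdivrMr ?ltr_pwDl ?sumr_ge0// ler_peMr// lerDl sumr_ge0.
Qed.

(** All attractions together are at most [N * A / (t + 1)], hence [G = N * A] in
    [choice_lower_bound]. *)
Lemma sale_prob_ge : exists2 B : R, 2 <= B &
  forall t S i, i \in S -> (t%:R + B)^-1 <= sale_prob t S i.
Proof.
have [A A0 leA] := margin_decay xi q pX_pmf mu_gt0 mu_le1 betap_lt0.
have [M M0 leM] := weight_ubound q.
have [|B B2 leB] := choice_lower_bound xi q pX_pmf mu_gt0 mu_le1 betap_lt0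
  (ltW M0) (_ : 0 <= N * A).
  by rewrite mulr_ge0// ltW.
exists B => // t S i iS; apply: (leB t i) => w; rewrite mnl_myopic.
have m0 j : 0 <= - betap * margin w j (r t j) by rewrite mulr_ge0 ?ltW ?margin_gt0.
have c0 := weight_gt0 q w i; have y0 := growth_gt0 xi pX mu betap q t i.
have A0' := ltW A0; have cy0 : 0 < weight q w i / (growth xi pX mu betap q t i + M).
  by rewrite divr_gt0 ?addr_gt0.
have G0 : 0 < 1 + N * A / t.+1%:R by rewrite ltr_pwDl ?divr_ge0 ?mulr_ge0.
rewrite ler_pM ?invr_ge0 ?(ltW cy0) ?(ltW G0)//.
  apply: le_trans (margin_growth_ge xi pX mu q betap_lt0 w t i).
  by rewrite ler_wpM2l ?(ltW c0)// lef_pV2 ?posrE ?addr_gt0// lerD2l.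
rewrite lef_pV2 ?posrE ?ltr_pwDl ?sumr_ge0 ?divr_ge0 ?mulr_ge0// lerD2l.
by rewrite -mulrA sum_le_card ?divr_ge0.
Qed.

Lemma cross_loss_le : exists2 C : R, 0 <= C & forall t S,
  mu * E (fun w => \sum_(i in S)
        margin w i (r t i) * \sum_(j in S :\ i) - betap * margin w j (r t j))
  <= C / t.+1%:R ^+ 2.
Proof.
have [A A0 leA] := margin_decay xi q pX_pmf mu_gt0 mu_le1 betap_lt0.
have m0 w j t : 0 <= - betap * margin w j (r t j) by rewrite mulr_ge0 ?ltW ?margin_gt0.
exists (N * (A / - betap * (N * A))).
  by rewrite !mulr_ge0 ?invr_ge0// ltW.
move=> t S; have t0 : 0 <= A / t.+1%:R by rewrite divr_ge0// ltW.
apply: (@le_trans _ _ (E (fun w => \sum_(i in S)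
    margin w i (r t i) * \sum_(j in S :\ i) - betap * margin w j (r t j)))).
  rewrite ler_piMl// expect_ge0// => w; apply: sumr_ge0 => i _.
  by rewrite mulr_ge0 ?sumr_ge0// ltW// margin_gt0.
apply: expect_le => // w.
have -> : N * (A / - betap * (N * A)) / t.+1%:R ^+ 2
    = N * ((A / t.+1%:R) / - betap * (N * (A / t.+1%:R))).
  by field; rewrite addrC natr1 pnatr_eq0 (lt_eqF betap_lt0).
rewrite sum_le_card// => [|i _]; first by rewrite !mulr_ge0 ?invr_ge0// ltW.
apply: ler_pM; rewrite ?sumr_ge0 ?(ltW (margin_gt0 _ _ _ _ _))//; last by rewrite sum_le_card.
by rewrite ler_pdivlMr// mulrC.
Qed.

(* With [x = 1 / (t + B)], at least two options sell with probability at least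
   [x] each, and [1 - 2 x <= (1 - x) ^+ 2]; so the gap times [(t + B - 1) ^+ 2]
   grows by a bounded amount in each period. *)
Lemma gap_decay : exists2 K : R, 0 <= K & forall t S, gap t S <= K / t.+1%:R.
Proof.
(* Induction on the cardinality of [S], since a sale leaves [S :\ i]. *)
suff [K K0 leK] : exists2 K : R, 0 <= K &
    forall S, (#|S| <= #|opt L Kb|)%N -> forall t, gap t S <= K / t.+1%:R.
  by exists K => // t S; apply: leK; exact: max_card.
have [A A0 leA] := margin_decay xi q pX_pmf mu_gt0 mu_le1 betap_lt0.
have [B B2 leB] := sale_prob_ge.
have [C C0 leC] := cross_loss_le.
elim: #|opt L Kb| => [|n [K K0 IH]].
  by exists 0 => // S S0 t; rewrite gap_le1_eq0 ?mul0r// (leq_trans S0).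
(* [A * K] comes from a sale, of probability at most [A / (t + 1)], followed by the gap of a smaller
   set, at most [K / (t + 1)]; [C] comes from the interaction. *)
pose C' := N * (A * K) + C.
have C'0 : 0 <= C' by rewrite addr_ge0// !mulr_ge0// ltW.
have CB0 : 0 <= C' * B ^+ 2 := mulr_ge0 C'0 (sqr_ge0 B).
(* [B ^+ 2] comes from [(t + B) / (t + 1) <= B]; adding [K] keeps the bound valid for smaller
   sets. *)
exists (K + C' * B ^+ 2); first exact: addr_ge0.
move=> S; rewrite leq_eqVlt => /predU1P[Sn t|]; last first.
  move=> Sn t; apply: le_trans (IH S _ t) _ => //.
  by rewrite ler_wpM2r// lerDl.
have [S1|S2] := leqP #|S| 1.
  by rewrite gap_le1_eq0// divr_ge0// addr_ge0.
have step u : gap u.+1 S <= gap u S * (1 - (u%:R + B)^-1) ^+ 2 + C' / u.+1%:R ^+ 2.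
  have x0 : 0 < (u%:R + B)^-1 by rewrite invr_gt0 ltr_wpDl//; lra.
  have sum_ge : 1 - \sum_(i in S) sale_prob u S i <= (1 - (u%:R + B)^-1) ^+ 2.
    have : \sum_(i in S) (u%:R + B)^-1 <= \sum_(i in S) sale_prob u S i.
      by apply: ler_sum => i iS; exact: leB.
    have : 2 * (u%:R + B)^-1 <= \sum_(i in S) (u%:R + B)^-1.
      by rewrite sumr_const -[leRHS]mulr_natl ler_wpM2r ?ler_nat// ltW.
    by have := sqr_ge0 ((u%:R + B)^-1); nra.
  apply: le_trans (gapS_le u S) _; rewrite -addrA lerD ?ler_wpM2l ?gap_ge0//.
  rewrite /C' mulrDl lerD//.
  have AK0 : 0 <= A * K / u.+1%:R ^+ 2 by rewrite divr_ge0 ?sqr_ge0// mulr_ge0// ltW.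
  rewrite -mulrA sum_le_card// => i iS.
  have -> : A * K / u.+1%:R ^+ 2 = (A / u.+1%:R) * (K / u.+1%:R) :> R
    by field; rewrite addrC natr1 pnatr_eq0.
  apply: ler_pM; rewrite ?gap_ge0 ?sale_prob_le//.
    by rewrite mulr_ge0 ?expect_ge0 ?ltW// => w; exact: mnl_ge0.
  by apply: IH; move: Sn; rewrite (cardsD1 i) iS add1n => /succn_inj ->.
have bound : (t%:R + B - 1) ^+ 2 * gap t S <= C' * B ^+ 2 * t%:R.
  elim: t => [|u IHu]; first by rewrite gap0 !mulr0.
  have uB : 0 < u%:R + B by rewrite ltr_wpDl//; lra.
  rewrite -natr1 (_ : u%:R + 1 + B - 1 = u%:R + B); last by ring.
  apply: le_trans (ler_wpM2l (sqr_ge0 _) (step u)) _; rewrite mulrDr.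
  have -> : (u%:R + B) ^+ 2 * (gap u S * (1 - (u%:R + B)^-1) ^+ 2)
      = (u%:R + B - 1) ^+ 2 * gap u S by field; rewrite gt_eqF.
  rewrite [in leRHS]mulrDr mulr1 lerD// mulrCA ler_wpM2l// -expr_div_n.
  have B0 : 0 <= B by lra.
  rewrite lerXn2r ?nnegrE ?divr_ge0 ?(ltW uB)//.
  rewrite ler_pdivrMr// -natr1; have : 0 <= u%:R :> R by []. nra.
(* Here [B >= 2] turns the weight [(t + B - 1) ^+ 2] into [(t + 1) ^+ 2]. *)
have tB : t.+1%:R <= t%:R + B - 1 by rewrite -natr1; lra.
have t0 : 0 < t.+1%:R :> R by [].
have le1 : t.+1%:R ^+ 2 * gap t S <= C' * B ^+ 2 * t.+1%:R.
  apply: le_trans (_ : C' * B ^+ 2 * t%:R <= _); last first.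
    by rewrite ler_wpM2l ?ler_nat.
  apply: le_trans bound; rewrite ler_wpM2r ?gap_ge0// lerXn2r ?nnegrE//.
  exact: le_trans tB.
rewrite ler_pdivlMr// mulrC -(ler_pM2r t0) mulrAC -expr2.
by apply: le_trans le1 _; rewrite ler_wpM2r// lerDr.
Qed.

End Gap.

(** The inductive bound is [2 - 1 / n], since [1 / (n + 1) ^+ 2 <= 1 / n - 1 / (n + 1)]. *)
Lemma sum_inv_sqr_le (R : realType) (n : nat) :
  \sum_(0 <= t < n) (t.+1%:R ^+ 2)^-1 <= 2 :> R.
Proof.
case: n => [|n]; first by rewrite big_geq.
suff : \sum_(0 <= t < n.+1) (t.+1%:R ^+ 2)^-1 <= 2 - n.+1%:R^-1 :> R.
  by move=> le2; apply: le_trans le2 _; rewrite gerBl invr_ge0.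
elim: n => [|n IH]; first by rewrite big_nat1 expr1n invr1; lra.
rewrite big_nat_recr//=; apply: le_trans (lerD IH (lexx _)) _.
have : 0 < n.+1%:R :> R by [].
rewrite -[n.+2%:R]natr1; move: (n.+1%:R) => a a0.
rewrite -subr_ge0.
have -> : 2 - (a + 1)^-1 - (2 - a^-1 + ((a + 1) ^+ 2)^-1) = (a * (a + 1) ^+ 2)^-1.
  by field; rewrite !gt_eqF//; lra.
by rewrite invr_ge0 mulr_ge0 ?sqr_ge0 ?ltW.
Qed.

(** * The gap between V^U and V^DFA *)

Section Forward.
Variables (R : realType) (L Kb : nat) (Omega : finType).
Variables (xi : 'I_L -> R) (pX : Omega -> R) (mu betap : R).
Variable q : Omega -> opt L Kb -> R.
Hypotheses (pX_pmf : is_pmf pX) (mu_gt0 : 0 < mu) (mu_le1 : mu <= 1).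
Hypothesis betap_lt0 : betap < 0.
Implicit Types (S : {set opt L Kb}) (i : opt L Kb) (w : Omega) (t T k : nat).
Implicit Types (p a : opt L Kb -> R).

Local Notation r := (item_bound betap q mu xi pX).
Local Notation tau := (tauU betap q mu xi pX).
Local Notation U := (VU betap q mu xi pX).
Local Notation W := (VDFA betap q mu xi pX).
Local Notation E := (expect pX).
Local Notation margin := (margin betap q).
Local Notation avail := (avail betap q mu xi pX).
Local Notation mnl_avail := (mnl_avail betap q).
Local Notation choice := (mean_choice betap q pX).
Local Notation N := #|opt L Kb|%:R.

Let betapN_gt0 : 0 < - betap. Proof. by rewrite oppr_gt0. Qed.

Lemma mnl_avail_sum_ge0 S w i p a : (forall j, 0 <= a j) ->
  0 <= \sum_(j in S :\ i) a j * attraction betap q w p j.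
Proof. by move=> a0; apply: sumr_ge0 => j _; rewrite mulr_ge0 ?expR_ge0. Qed.

Lemma mnl_avail_01 S w i p a : (forall j, 0 <= a j) ->
  0 <= mnl_avail S w i p a <= 1.
Proof.
move=> /(mnl_avail_sum_ge0 S w i p) s0; have e0 : 0 < attraction betap q w p i := expR_gt0 _.
rewrite /Defs.mnl_avail; apply/andP; split.
  by apply: divr_ge0; lra.
by rewrite ler_pdivrMr; lra.
Qed.

Lemma mean_choice_01 S i p a : (forall j, 0 <= a j) -> 0 <= choice S i p a <= 1.
Proof.
move=> a0; rewrite expect_ge0//= => [|w]; last by case/andP: (mnl_avail_01 S w i p a0).
by apply: expect_le => // w; case/andP: (mnl_avail_01 S w i p a0).
Qed.

Lemma availT S T i : avail S T T i = 1.
Proof. by rewrite /Defs.avail subnn. Qed.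

Lemma avail_prev S T t i : (t < T)%N ->
  avail S T t i = avail S T t.+1 i * (1 - mu * choice S i (tau t.+1) (avail S T t.+1)).
Proof.
move=> tT; rewrite /Defs.avail.
have -> : (T - t)%N = (T - t.+1).+1 by rewrite subnSK.
by rewrite /= subKn.
Qed.

Lemma avail_01 S T t i : 0 <= avail S T t i <= 1.
Proof.
rewrite /Defs.avail; elim: (T - t)%N i => [|k IH] i; first by rewrite ler01 lexx.
have a0 j : 0 <= avail_elapsed betap q mu xi pX S T k j by case/andP: (IH j).
have /andP[c0 c1] := mean_choice_01 S i (tau (T - k)%N) a0.
have /andP[A0 A1] := IH i => /=.
have : mu * choice S i (tau (T - k)%N) (avail_elapsed betap q mu xi pX S T k) <= 1.
  by rewrite mulr_ile1// ltW.
have := mulr_ge0 (ltW mu_gt0) c0 => m0 m1.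
by rewrite mulr_ge0 ?mulr_ile1//; lra.
Qed.

Lemma attraction_tauU_le w t i :
  attraction betap q w (tau t) i <= - betap * margin w i (r t i).
Proof.
have [_ le_tau] := tauUP xi mu q pX_pmf betap_lt0 t i.
by rewrite -attraction_myopic// ler_expR lerD2l ler_wnM2l ?le_tau// ltW.
Qed.

(** The price is optimal for some type [w'], whose factor [exp (b m)] is at most
    [1 + weight / growth]; so taking the largest price over types only adds a constant to the
    denominator. *)
Lemma attraction_tauU_ge M w t i : (forall w i, weight q w i <= M) ->
  weight q w i / (growth xi pX mu betap q t i + M) <= attraction betap q w (tau t) i.
Proof.
move=> leM; rewrite /attraction; have [[w' ->] _] := tauUP xi mu q pX_pmf betap_lt0 t i.
have y0 := growth_gt0 xi pX mu betap q t i.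
have c0 := weight_gt0 q w i; have c0' := weight_gt0 q w' i.
have -> : q w i + betap * myopic_price betap q w' i (r t i)
        = (q w i - 1 + betap * r t i) - - betap * margin w' i (r t i).
  by rewrite /myopic_price; field; rewrite lt_eqF.
rewrite expRB weight_growth.
have := expR_margin_le q betap_lt0 w' i (r t i); rewrite weight_growth => le_e.
rewrite -mulrA -invfM ler_wpM2l ?(ltW c0)//.
rewrite lef_pV2 ?posrE ?mulr_gt0 ?expR_gt0 ?addr_gt0//; last first.
  exact: lt_le_trans (leM w i).
apply: le_trans (ler_wpM2l (ltW y0) le_e) _.
by rewrite mulrDr mulr1 [X in _ + X]mulrC divfK ?gt_eqF// lerD2l.
Qed.

Lemma mean_choice_ge : exists2 B : R, 2 <= B &
  forall S t i a, (forall j, 0 <= a j <= 1) ->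
    (t%:R + B)^-1 <= mu * choice S i (tau t) a.
Proof.
have [A A0 leA] := margin_decay xi q pX_pmf mu_gt0 mu_le1 betap_lt0.
have [M M0 leM] := weight_ubound q.
(* In the denominator, [A] stands for the option itself and [N * A] for its competitors. *)
have NA0 : 0 <= A + N * A by rewrite addr_ge0 ?mulr_ge0 ?(ltW A0).
have [B B2 leB] := choice_lower_bound xi q pX_pmf mu_gt0 mu_le1 betap_lt0 (ltW M0) NA0.
exists B => // S t i a a01; apply: (leB t i) => w.
have a0 j : 0 <= a j by case/andP: (a01 j).
have c0 := weight_gt0 q w i; have y0 := growth_gt0 xi pX mu betap q t i.
have At0 : 0 <= A / t.+1%:R by rewrite divr_ge0// ltW.
have cy0 : 0 < weight q w i / (growth xi pX mu betap q t i + M).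
  by rewrite divr_gt0 ?addr_gt0.
have G0 : 0 < 1 + (A + N * A) / t.+1%:R by rewrite ltr_pwDl ?divr_ge0.
have e0 : 0 < attraction betap q w (tau t) i := expR_gt0 _.
have e_le j : attraction betap q w (tau t) j <= A / t.+1%:R.
  exact: le_trans (attraction_tauU_le _ _ _) (leA _ _ _).
have s0 := mnl_avail_sum_ge0 S w i (tau t) a0.
rewrite ler_pM ?invr_ge0 ?(ltW cy0) ?(ltW G0)//; first exact: attraction_tauU_ge.
have d0 : 0 < 1 + attraction betap q w (tau t) i
    + \sum_(j in S :\ i) a j * attraction betap q w (tau t) j by lra.
rewrite lef_pV2 ?posrE// -addrA lerD2l mulrDl -mulrA lerD// sum_le_card// => j _.
case/andP: (a01 j) => _ aj1; apply: le_trans (e_le j).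
by rewrite ler_piMl ?expR_ge0.
Qed.

(** The survival factors [1 - 1 / (u + B) = (u + B - 1) / (u + B)] telescope to
    [(t + B) / (T + B)]. *)
Lemma avail_decay : exists2 B : R, 1 <= B &
  forall S T t i, (t <= T)%N -> avail S T t i <= B * t.+1%:R / T.+1%:R.
Proof.
have [B B2 leB] := mean_choice_ge; exists B; first by lra.
move=> S T t i tT.
have tB u : 0 < u%:R + B by rewrite ltr_wpDl//; lra.
apply: (@le_trans _ _ ((t%:R + B) / (T%:R + B))); last first.
  have t0 : 0 <= t%:R :> R by [].
  have T0 : 0 <= T%:R :> R by [].
  rewrite ler_pM ?invr_ge0 ?(ltW (tB _))//.
    by rewrite -natr1; nra.
  by rewrite lef_pV2 ?posrE// -natr1; lra.
have [k kE] : exists k, (t + k = T)%N by exists (T - t)%N; rewrite subnKC.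
elim: k t kE {tT} i => [|k IH] t kE i.
  by rewrite -kE addn0 availT divff// gt_eqF.
have tT : (t < T)%N by rewrite -kE addnS ltnS leq_addr.
rewrite avail_prev//.
have a01 j := avail_01 S T t.+1 j.
have /andP[a0 _] := a01 i.
have t1E : t.+1%:R + B = t%:R + 1 + B :> R by rewrite -natr1.
apply: (@le_trans _ _ ((t.+1%:R + B) / (T%:R + B) * (1 - (t.+1%:R + B)^-1))).
  apply: ler_pM => //; last by rewrite lerD2l lerN2 leB.
    have /andP[c0 c1] := mean_choice_01 S i (tau t.+1) (fun j => (andP (a01 j)).1).
    have : mu * choice S i (tau t.+1) (avail S T t.+1) <= 1 by rewrite mulr_ile1// ltW.
    by lra.
  by apply: IH; rewrite -kE addSnnS.
rewrite mulrAC mulrBr mulr1 divff ?gt_eqF// t1E.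
by rewrite ler_wpM2r ?invr_ge0 ?(ltW (tB _))//; lra.
Qed.

(** In period [t + 1] the opportunity cost is [r t i], whereas the trajectory price is computed from
    [r t.+1 i]. *)
Let loss S T t i w : R :=
  margin w i (r t i)
  - mnl_avail S w i (tau t.+1) (avail S T t.+1) * (tau t.+1 i - r t i).

(** Telescope [avail S T t i * r t i]: at time 0 it is the salvage term of [W], and at the horizon,
    where availability is 1, it is [r T i]. *)
Lemma VU_sub_VDFA T S : U T S - W T S =
  mu * \sum_(0 <= t < T) \sum_(i in S) avail S T t.+1 i * E (loss S T t i).
Proof.
rewrite /VDFA /VU opprD addrA -sumrB big_add1 [_.+1.-1]/=.
have -> : \sum_(i in S) (r T i - avail S T 0 i * salvage xi i)
  = \sum_(0 <= t < T) \sum_(i in S) (avail S T t.+1 i * r t.+1 i - avail S T t i * r t i).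
  rewrite exchange_big/=; apply: eq_bigr => i _.
  by rewrite (telescope_sumr (fun t => avail S T t i * r t i))// availT mul1r.
rewrite !mulr_sumr -sumrB; apply: eq_big_nat => t /andP[_ tT].
rewrite !mulr_sumr -sumrB; apply: eq_bigr => i _.
rewrite (avail_prev S i tT) item_boundS//.
have -> : E (loss S T t i) = E (fun w => margin w i (r t i))
    - choice S i (tau t.+1) (avail S T t.+1) * (tau t.+1 i - r t i).
  rewrite expectB; congr (_ - _); rewrite mulrC -expectZ.
  by apply: eq_bigr => w _; rewrite [mnl_avail _ _ _ _ _ * _]mulrC.
ring.
Qed.

Lemma VDFA_le_VU T S : W T S <= U T S.
Proof.
rewrite -subr_ge0 VU_sub_VDFA mulr_ge0 ?(ltW mu_gt0)//.
apply: sumr_ge0 => t _; apply: sumr_ge0 => i _.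
have a01 j := avail_01 S T t.+1 j; have a0 j := (andP (a01 j)).1.
rewrite mulr_ge0// expect_ge0// => w; rewrite subr_ge0.
apply: margin_gap_ge0 => //; exact: mnl_avail_sum_ge0.
Qed.

Lemma DFA_gap_decay : exists2 K : R, 0 <= K & forall T S, U T S - W T S <= K / T.+1%:R.
Proof.
have [A A0 leA] := margin_decay xi q pX_pmf mu_gt0 mu_le1 betap_lt0.
have [B B1 leB] := avail_decay.
have m0 w j t : 0 < - betap * margin w j (r t j) by rewrite mulr_gt0 ?margin_gt0.
have B0 : 0 <= B by lra.
have N0 : 0 <= N :> R by [].
(* Availability at most [2 * B * (t + 1) / (T + 1)] times margin at most [A / (- betap * (t + 1))]:
   the time cancels and leaves [C / (T + 1)]. *)
pose C := 2 * B * (A / - betap).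
have C0 : 0 <= C by rewrite !mulr_ge0 ?invr_ge0 ?(ltW A0) ?(ltW betapN_gt0).
(* The remaining factors have a bounded sum: 2 bounds the sum of inverse squares, and
   [N * B * A / (T + 1)] is added [T] times. *)
exists (N * (C * (4 * A ^+ 2 * 2 + N * B * A))).
  by rewrite mulr_ge0// mulr_ge0// addr_ge0// !mulr_ge0 ?(ltW A0)// sqr_ge0.
move=> T S; have T0 : 0 < T.+1%:R :> R by [].
have term t i : (t < T)%N -> avail S T t.+1 i * E (loss S T t i)
    <= C / T.+1%:R * (4 * A ^+ 2 * (t.+1%:R ^+ 2)^-1 + N * B * A / T.+1%:R).
  move=> tT; have t0 : 0 < t.+1%:R :> R by [].
  have a01 j := avail_01 S T t.+1 j; have a0 j := (andP (a01 j)).1.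
  have a_le j := leB S T t.+1 j tT.
  have leA' w j : - betap * margin w j (r t.+1 j) <= A / t.+1%:R.
    apply: le_trans (leA w t.+1 j) _; rewrite ler_wpM2l ?(ltW A0)//.
    by rewrite lef_pV2 ?posrE// ler_nat.
  have loss_le w : loss S T t i w
      <= A / t.+1%:R / - betap * ((2 * (A / t.+1%:R)) ^+ 2 + N * B * A / T.+1%:R).
    have s0 := mnl_avail_sum_ge0 S w i (tau t.+1) a0.
    have [[w' tauE] le_tau] := tauUP xi mu q pX_pmf betap_lt0 t.+1 i.
    (* The price error is nonnegative because [r] increases and the trajectory takes the largest
       price over types. *)
    have p_le : myopic_price betap q w i (r t i) <= tau t.+1 i.
      by apply: le_trans (le_tau w); apply: le_myopic_price => //; exact: le_item_boundS.
    apply: le_trans (margin_gap_le betap_lt0 s0 p_le) _.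
    have u0 : 0 <= - betap * (tau t.+1 i - myopic_price betap q w i (r t i)).
      by rewrite mulr_ge0 ?subr_ge0 ?(ltW betapN_gt0).
    apply: ler_pM; rewrite ?addr_ge0 ?sqr_ge0 ?(ltW (margin_gt0 _ _ _ _ _))//.
      by rewrite ler_pdivlMr// mulrC.
    apply: lerD.
      have A2 : 0 <= 2 * (A / t.+1%:R) by rewrite !mulr_ge0 ?invr_ge0 ?(ltW A0).
      rewrite lerXn2r ?nnegrE//.
      rewrite tauE /myopic_price item_boundS//.
      (* The price error is the increment of [r] plus a difference of two margins. Scaled by
         [- betap], the increment and the added margin are each at most [A / (t + 1)], hence the
         factor 2. *)
      have drift : mu * E (fun w => - betap * margin w i (r t i)) <= A / t.+1%:R.
        apply: (@le_trans _ _ (E (fun w => - betap * margin w i (r t i)))).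
          by rewrite ler_piMl// expect_ge0// => w''; exact: ltW.
        exact: expect_le.
      rewrite expectZ in drift.
      have := leA' w' i; have := m0 w i t; rewrite item_boundS//.
      by move: drift; move: (A / t.+1%:R) => x; lra.
    rewrite -!mulrA sum_le_card ?mulr_ge0 ?invr_ge0 ?(ltW A0)// => j _.
    (* Availability times attraction of a competitor: the factors [t + 2] cancel, leaving a term of
       order [1 / T]. *)
    apply: (@le_trans _ _ ((B * t.+2%:R / T.+1%:R) * (A / t.+2%:R))).
      rewrite ler_pM ?expR_ge0//; apply: le_trans (leA w t.+1 j).
      exact: attraction_tauU_le.
    rewrite le_eqVlt; apply/orP; left; apply/eqP.
    by field; rewrite nat1r -natrD !pnatr_eq0.
  have X0 : 0 <= A / t.+1%:R / - betap * ((2 * (A / t.+1%:R)) ^+ 2 + N * B * A / T.+1%:R).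
    by rewrite mulr_ge0 ?divr_ge0 ?addr_ge0 ?sqr_ge0 ?divr_ge0 ?mulr_ge0
      ?(ltW A0) ?(ltW betapN_gt0).
  apply: (@le_trans _ _ (B * (2 * t.+1%:R) / T.+1%:R *
      (A / t.+1%:R / - betap * ((2 * (A / t.+1%:R)) ^+ 2 + N * B * A / T.+1%:R)))).
    apply: le_trans (ler_wpM2l (a0 i) (expect_le pX_pmf loss_le)) _.
    rewrite ler_wpM2r//; apply: le_trans (a_le i) _.
    rewrite ler_wpM2r ?invr_ge0// ler_wpM2l// -[t.+2%:R]natr1.
    have : 1 <= t.+1%:R :> R by rewrite ler1n.
    lra.
  rewrite le_eqVlt; apply/orP; left; apply/eqP; rewrite /C; field.
  by rewrite !nat1r !pnatr_eq0 (lt_eqF betap_lt0).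
rewrite VU_sub_VDFA; set X := \sum_(0 <= t < T) _.
have X0 : 0 <= X.
  by rewrite -(pmulr_rge0 _ mu_gt0) -VU_sub_VDFA subr_ge0 VDFA_le_VU.
have AA0 : 0 <= 4 * A ^+ 2 by rewrite mulr_ge0// sqr_ge0.
have NBA0 : 0 <= N * B * A by rewrite !mulr_ge0// ltW.
apply: (@le_trans _ _ X); first by rewrite ler_piMl.
apply: (@le_trans _ _ (\sum_(0 <= t < T)
    N * (C / T.+1%:R * (4 * A ^+ 2 * (t.+1%:R ^+ 2)^-1 + N * B * A / T.+1%:R)))).
  apply: ler_sum_nat => t /andP[_ tT]; apply: sum_le_card => [|i _]; last exact: term.
  by rewrite mulr_ge0 ?addr_ge0 ?divr_ge0 ?sqr_ge0.
rewrite -mulr_sumr -mulr_sumr big_split/= -mulr_sumr sumr_const_nat subn0.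
have -> : N * (C * (4 * A ^+ 2 * 2 + N * B * A)) / T.+1%:R
    = N * (C / T.+1%:R * (4 * A ^+ 2 * 2 + N * B * A)) by ring.
rewrite ler_wpM2l// ler_wpM2l ?divr_ge0// lerD//.
  by rewrite ler_wpM2l ?sum_inv_sqr_le.
by rewrite -[leLHS]mulr_natr mulrAC ler_pdivrMr// (ler_wpM2l NBA0)// ler_nat.
Qed.

End Forward.

(** * From the number of periods to the demand, and relative gaps *)

Section Asymptotics.
Variables (R : realType) (L Kb : nat) (Omega : finType).
Variables (xi : 'I_L -> R) (pX : Omega -> R) (mu betap : R).
Variable q : Omega -> opt L Kb -> R.
Hypotheses (pX_pmf : is_pmf pX) (mu_gt0 : 0 < mu) (mu_le1 : mu <= 1).
Hypothesis betap_lt0 : betap < 0.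
Implicit Types (S : {set opt L Kb}) (t T : nat).

Local Notation V := (Vstar betap q mu xi pX).
Local Notation U := (VU betap q mu xi pX).
Local Notation W := (VDFA betap q mu xi pX).

(** As [mu <= 1], [lambda <= lambda / mu], which is less than [periods mu lambda + 1]. *)
Lemma periods_inv_le (lambda : R) : 0 < lambda ->
  (periods mu lambda).+1%:R^-1 <= lambda^-1.
Proof.
move=> l0; rewrite lef_pV2 ?posrE// ltW// (le_lt_trans _ (truncnS_gt _))//.
by rewrite ler_peMr ?(ltW l0)// invf_ge1.
Qed.

(** Both [V] and [W] lie below [U], so their distances to [U] control their mutual distance. *)
Lemma value_gaps : exists2 K : R, 0 <= K & forall t S,
  `|U t S - V t S| <= K / t.+1%:R /\ `|W t S - V t S| <= K / t.+1%:R.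
Proof.
have [K1 K1_ge0 leK1] := gap_decay xi q pX_pmf mu_gt0 mu_le1 betap_lt0.
have [K2 K2_ge0 leK2] := DFA_gap_decay xi q pX_pmf mu_gt0 mu_le1 betap_lt0.
exists (K1 + K2) => [|t S]; first exact: addr_ge0.
have := gap_ge0 xi q pX_pmf mu_gt0 mu_le1 betap_lt0 t S.
have := VDFA_le_VU xi q pX_pmf mu_gt0 mu_le1 betap_lt0 t S.
have := leK1 t S; have := leK2 t S; rewrite /gap mulrDl.
have : 0 <= K1 / t.+1%:R by rewrite divr_ge0.
have : 0 <= K2 / t.+1%:R by rewrite divr_ge0.
move: (K1 / _) (K2 / _) => k1 k2 k2_ge0 k1_ge0 *.
by rewrite !ler_norml; split; lra.
Qed.

(** Each option's bound eventually exceeds [1 + K], and the gap to [U] is at most [K]. *)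
Lemma Vstar_ge1 S : S != finset.set0 -> exists t0, forall t, (t0 <= t)%N -> 1 <= V t S.
Proof.
case/finset.set0Pn => i iS; have [K K0 leK] := value_gaps.
have [t0 let0] := item_bound_ge_eventually xi q pX_pmf mu_gt0 mu_le1 betap_lt0 (1 + K).
exists t0 => t t0t; have [+ _] := leK t S.
have : K / t.+1%:R <= K by rewrite ler_piMr// invf_le1// ler1n.
have : 1 + K <= U t S.
  rewrite /VU (big_setD1 i)//= -[leLHS]addr0 lerD ?let0// sumr_ge0// => j _.
  by apply: le_trans (let0 t j t0t); lra.
by rewrite ler_norml; move: (K / _) => k *; lra.
Qed.

Lemma Vstar_set0 t : V t finset.set0 = 0.
Proof.
have := gap_le1_eq0 xi q pX_pmf mu_gt0 mu_le1 betap_lt0 t (S := finset.set0).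
rewrite cards0 => /(_ isT)/eqP; rewrite subr_eq0 => /eqP <-.
by rewrite /VU big_set0.
Qed.

Lemma relative_gap_bigO (F : nat -> R) (K : R) S : 0 <= K ->
  (forall t, `|F t - V t S| <= K / t.+1%:R) ->
  (fun lambda : R => (F (periods mu lambda) - V (periods mu lambda) S)
      / V (periods mu lambda) S) =O_ +oo (fun lambda : R => lambda^-1).
Proof.
(* [K] may be 0, whereas the constant must be positive. *)
move=> K0 leF; apply/eqO_exP; exists (K + 1); first by lra.
(* Without items the empty set is feasible; then [V] is 0, and so is the quotient, by the convention
   on the inverse of 0. *)
have [->|S0] := eqVneq S finset.set0.
  by near=> lambda; rewrite Vstar_set0 invr0 mulr0 normr0 mulr_ge0//; lra.
have [t0 let0] := Vstar_ge1 S0.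
near=> lambda.
have l0 : 0 < lambda by near: lambda; exact: nbhs_pinfty_gt.
have V1 : 1 <= V (periods mu lambda) S.
  apply: let0; rewrite truncn_ge_nat ?divr_ge0 ?(ltW l0) ?(ltW mu_gt0)//
    (ler_pdivlMr _ _ mu_gt0).
  by near: lambda; apply: nbhs_pinfty_ge; exact: num_real.
rewrite normrM normfV (ger0_norm (le_trans ler01 V1))
  (@ger0_norm _ lambda^-1) ?invr_ge0 ?(ltW l0)//.
apply: le_trans (_ : K * lambda^-1 <= _); last first.
  by rewrite ler_wpM2r ?invr_ge0 ?(ltW l0)//; lra.
rewrite ler_pdivrMr; last by lra.
apply: le_trans (leF _) _; apply: le_trans (ler_wpM2l K0 (periods_inv_le l0)) _.
by rewrite ler_peMr// mulr_ge0// invr_ge0 ltW.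
Unshelve. all: by end_near. Qed.

End Asymptotics.

Theorem theorem4 (R : realType) (L Kb Ks : nat) (Omega : finType)
    (xi : 'I_L -> R) (pX : Omega -> R) (mu betap : R)
    (q : Omega -> opt L Kb -> R)
    (pX_pmf : is_pmf pX) (mu_gt0 : 0 < mu) (mu_le1 : mu <= 1)
    (betap_lt0 : betap < 0)
    (S : {set opt L Kb}) (S_feasible : S \in feasible L Kb Ks) :
  let V lambda := Vstar betap q mu xi pX (periods mu lambda) S in
  let W lambda := VDFA betap q mu xi pX (periods mu lambda) S in
  let U lambda := VU betap q mu xi pX (periods mu lambda) S in
  [/\ (W lambda - V lambda) @[lambda --> +oo] --> (0 : R),
      (fun lambda : R => (W lambda - V lambda) / V lambda)
        =O_ +oo (fun lambda : R => lambda^-1)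
    & (fun lambda : R => (U lambda - V lambda) / V lambda)
        =O_ +oo (fun lambda : R => lambda^-1)].
Proof.
move=> V W U.
have [K K0 leK] := value_gaps xi q pX_pmf mu_gt0 mu_le1 betap_lt0.
split.
- apply/cvgrPdist_le => e e0; near=> lambda; rewrite sub0r normrN.
  have l0 : 0 < lambda by near: lambda; exact: nbhs_pinfty_gt.
  apply: le_trans (leK _ S).2 _.
  apply: le_trans (ler_wpM2l K0 (periods_inv_le mu_gt0 mu_le1 l0)) _.
  rewrite (ler_pdivrMr _ _ l0) mulrC -(ler_pdivrMr _ _ e0).
  by near: lambda; apply: nbhs_pinfty_ge; exact: num_real.
- by apply: (relative_gap_bigO (F := fun t => VDFA betap q mu xi pX t S) pX_pmf
    _ _ _ K0) => // t; have [] := leK t S.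
- by apply: (relative_gap_bigO (F := fun t => VU betap q mu xi pX t S) pX_pmf
    _ _ _ K0) => // t; have [] := leK t S.
Unshelve. all: by end_near. Qed.
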